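(* Let $S\subset\mathbb{R}^2$ be a Minkowski-centered triangle. The diagram $f_{\mathrm{MIN}}(\bar{\mathcal{C}}^2,S)$ is fully described by the inequalities $$D_{\mathrm{MIN}}(K,S)\le 3R(K,S),\qquad 2r(K,S)+R(K,S)\le D_{\mathrm{MIN}}(K,S),$$ $$\frac{D_{\mathrm{MIN}}(K,S)}{3R(K,S)}\left(1-\frac{D_{\mathrm{MIN}}(K,S)}{3R(K,S)}\right)\le\frac{r(K,S)}{R(K,S)}.$$ That is, $$f_{\mathrm{MIN}}(\bar{\mathcal{C}}^2,S)=\left\{(x,y)\in[0,\infty)^2:\ 2y\le 3,\ 2x+1\le 2y,\ \tfrac{2y}{3}\left(1-\tfrac{2y}{3}\right)\le x\right\}.$$
   Context: A convex body is a nonempty compact convex set. $\bar{\mathcal{C}}^2$ is the family of convex bodies in $\mathbb{R}^2$ that are not single points. For a convex body $C$ with $0$ in its interior, $\|x\|_C=\min\{\lambda\ge0:x\in\lambda C\}$ is the gauge function. For convex bodies $K,C$: the circumradius is $R(K,C)=\inf\{\rho\ge0:\exists t,\ K\subset t+\rho C\}$ and the inradius is $r(K,C)=\sup\{\rho\ge0:\exists t,\ t+\rho C\subset K\}$. The Minkowski asymmetry is $s(C)=R(C,-C)$, and $C$ is Minkowski-centered if $C\subset -s(C)C$. (Triangles are understood to be full-dimensional; a Minkowski-centered triangle contains $0$ in its interior.) The minimum diameter is $D_{\mathrm{MIN}}(K,C)=\max_{x,y\in K}\|x-y\|_C$. For $K\in\bar{\mathcal{C}}^2$, $f_{\mathrm{MIN}}(K,C)=\left(\frac{r(K,C)}{R(K,C)},\frac{D_{\mathrm{MIN}}(K,C)}{2R(K,C)}\right)$,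 and $f_{\mathrm{MIN}}(\bar{\mathcal{C}}^2,C)=\{f_{\mathrm{MIN}}(K,C):K\in\bar{\mathcal{C}}^2\}$ is the Blaschke-Santaló diagram. ''Fully described'' by inequalities means that every $K$ satisfies them and every pair of (nonnegative) values satisfying them is attained by some $K$. *)

(* Defs.v *)
From HB Require Import structures.
From mathcomp Require Import all_boot all_order all_algebra.
From mathcomp Require Import all_classical all_reals all_analysis.

Set Implicit Arguments.
Unset Strict Implicit.
Unset Printing Implicit Defensive.

Import Order.TTheory GRing.Theory Num.Theory.
Import numFieldNormedType.Exports.

Local Open Scope classical_set_scope.
Local Open Scope ring_scope.

Section ConvexBodies.
Context {R : realType} {V : normedModType R}.
Implicit Types (K C : set V) (x t : V).

Definition convex_body K : Prop :=
  [/\ K !=set0, compact K & convex_set (K : set (convex_lmodType V))].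

Definition nonsingleton_body K : Prop :=
  convex_body K /\ ~ (exists x, K = [set x]).

Definition dilate (l : R) C : set V := [set l *: x | x in C].

Definition translate t C : set V := [set t + x | x in C].

(* [inf] is the minimum of the paper whenever C is compact with 0 in its
   interior. *)
Definition gauge C x : R := inf [set l | 0 <= l /\ dilate l C x].

Definition circumradius K C : R :=
  inf [set rho | 0 <= rho /\ exists t, K `<=` translate t (dilate rho C)].

Definition inradius K C : R :=
  sup [set rho | 0 <= rho /\ exists t, translate t (dilate rho C) `<=` K].

Definition asymmetry C : R := circumradius C (dilate (-1) C).

Definition minkowski_centered C : Prop := C `<=` dilate (- asymmetry C) C.

(* [sup] is the maximum of the paper for K nonempty and compact.  The gauge is
   not symmetric, but both x - y and y - x occur in the set. *)
Definition diam_MIN K C : R := sup [set gauge C (x - y) | x in K & y in K].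

Definition f_MIN C K : R * R :=
  (inradius K C / circumradius K C, diam_MIN K C / (2 * circumradius K C)).

Definition BS_diagram C : set (R * R) := f_MIN C @` nonsingleton_body.

End ConvexBodies.

(* [smallest convex_set A] is the convex hull of A; the freeness condition says
   that a, b, c are affinely independent. *)
Definition triangle {R : realType} (S : set 'rV[R]_2) : Prop :=
  exists a b c : 'rV[R]_2, free [:: b - a; c - a] /\
    S = smallest (@convex_set R 'rV[R]_2) [set a; b; c].

(* Main.v *)
Require Import Defs.
From mathcomp Require Import all_boot all_order all_algebra.
From mathcomp Require Import all_classical all_reals all_analysis.
From mathcomp Require Import ring lra.
Import Order.TTheory GRing.Theory Num.Theory.
Import numFieldNormedType.Exports.
Local Open Scope classical_set_scope.
Local Open Scope ring_scope.

Set Implicit Arguments.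
Unset Strict Implicit.
Unset Printing Implicit Defensive.

(** Put the centroid of S at the origin; this is what Minkowski-centered means
    for a triangle.  Then S = {x | h_i(x) <= 1 for i = 0, 1, 2} for three linear
    functionals with h_0 + h_1 + h_2 = 0, two of which are coordinates of the
    plane (gauge_frame, centered_triangle_frame).  All the quantities become
    linear data: a homothetic copy t + rho S is {h_i <= h_i(t) + rho}, the gauge
    is the largest h_i, and with H_i the maximum of h_i on K one gets
    3 R(K,S) = H_0 + H_1 + H_2 while D(K,S) is the largest width of K in the
    directions h_i.

    The inequalities.  On K, h_i(x) - h_i(y) = h_i(x) + sum of h_j(y) over j
    different from i, which is at most 3R; so D <= 3R.  If t + rho S lies in K,
    some i has h_i(t) <= H_i - R because these differences add up to -3R, and the
    vertex of the copy where h_i is h_i(t) - 2 rho shows that the width in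
    direction i is at least R + 2 rho; so 2r + R <= D.  For the third
    inequality, scale so that K lies in a triangle of barycentric
    coordinates u_i = (H_i - h_i) / 3R and meets each of its sides, in points
    k_0 = (0, a, 1-a), k_1 = (1-b, 0, b), k_2 = (c, 1-c, 0).  All coordinates
    are at most d = D / 3R, so a, b, c lie in [1-d, d].  The triangle k_0 k_1 k_2
    contains a copy of S of size R (abc + (1-a)(1-b)(1-c)), with one vertex on
    each of its edges (touching_triangle_inradius), and the polynomial is
    at least d(1-d) on the box (triangle_ratio_ge).

    Attaining every value.  Let x = r/R and d = D/3R be prescribed with
    d(1-d) <= x <= (3d-1)/2; these bounds force d >= 1/2.  In barycentric
    coordinates of S take the hexagon 0 <= u_i <= d, and cut it by a bound g on
    u_0 and by a line d u_0 + (1-d) u_1 = e.  As long as the cuts spare the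
    three vertices (0, d, 1-d), (1-d, 0, d), (1-d, d, 0), the body has R = 1 and
    D = 3d (polygon_support).  A copy of S fits into such a polygon exactly when
    a few linear inequalities hold (copy_sub_polygon), and g and e can be tuned
    so that the largest copy has size x (tight_fit). *)

(** * Convex combinations and triples of indices *)

Section ConvexSets.
Context {R : realType} {V : normedModType R}.
Implicit Types (K : set V) (x y : V).

Lemma convex_setP K :
  convex_set (K : set (convex_lmodType V)) <->
  forall x y (l : R), 0 <= l <= 1 -> K x -> K y -> K (l *: x + (1 - l) *: y).
Proof.
split=> [cK x y l /andP[l0 l1] Kx Ky|cK x y l /set_mem Kx /set_mem Ky].
  have /set_mem := cK x y (Itv01 l0 l1) (mem_set Kx) (mem_set Ky).
  by rewrite /conv.
apply/mem_set; rewrite /conv /=; apply: cK => //.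
by rewrite ge0 le1.
Qed.

End ConvexSets.

Section ThreeIndices.

Lemma ord3P (P : 'I_3 -> Prop) : P 0 -> P 1 -> P 2 -> forall i, P i.
Proof.
move=> P0 P1 P2 [[|[|[|//]]] lti].
- by rewrite (_ : Ordinal lti = 0)//; apply: val_inj.
- by rewrite (_ : Ordinal lti = 1)//; apply: val_inj.
- by rewrite (_ : Ordinal lti = 2)//; apply: val_inj.
Qed.

Lemma sum_ord3 (V : nmodType) (f : 'I_3 -> V) : \sum_i f i = f 0 + f 1 + f 2.
Proof.
rewrite !big_ord_recl big_ord0 addr0 addrA.
by congr (f _ + f _ + f _); apply: val_inj.
Qed.

Definition triple {T : Type} (a b c : T) (i : 'I_3) : T :=
  if i == 0 then a else if i == 1 then b else c.

End ThreeIndices.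

Section Hull3.
Context {R : realType} {V : normedModType R}.

Lemma convex_set3 (K : set V) (p : 'I_3 -> V) (w : 'I_3 -> R) :
  convex_set (K : set (convex_lmodType V)) -> (forall i, K (p i)) ->
  (forall i, 0 <= w i) -> \sum_i w i = 1 -> K (\sum_i w i *: p i).
Proof.
move=> /convex_setP cK Kp w0; rewrite !sum_ord3 => w1.
have := w0 0; have := w0 1; have := w0 2 => w2_ge0 w1_ge0 w0_ge0.
(* The first two weights can only be renormalised when the third is not 1. *)
have [w2E|w2N1] := eqVneq (w 2) 1.
  have -> : w 0 = 0 by lra.
  have -> : w 1 = 0 by lra.
  by rewrite w2E !scale0r !add0r scale1r.
have s_gt0 : 0 < 1 - w 2 by rewrite subr_gt0 lt_neqAle w2N1; lra.
have l01 : 0 <= w 0 / (1 - w 2) <= 1.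
  by rewrite divr_ge0 ?ler_pdivrMr//; lra.
have := cK _ _ (w 2) _ (Kp 2) (cK _ _ _ l01 (Kp 0) (Kp 1)).
rewrite scalerDr !scalerA addrC mulrBr mulr1 mulrCA divff ?gt_eqF// mulr1.
have -> : 1 - w 2 - w 0 = w 1 by lra.
by apply; lra.
Qed.

End Hull3.

(** * Facet functionals of a centered triangle *)

Section Functionals.
Context {R : realType}.
Implicit Types (M : 'M[R]_(2, 3)) (x y : 'rV[R]_2) (i : 'I_3).

Definition facet M i x : R := (x *m M) 0 i.

Lemma facetD M i x y : facet M i (x + y) = facet M i x + facet M i y.
Proof. by rewrite /facet mulmxDl mxE. Qed.

Lemma facetN M i x : facet M i (- x) = - facet M i x.
Proof. by rewrite /facet mulNmx mxE. Qed.

Lemma facetZ M i (a : R) x : facet M i (a *: x) = a * facet M i x.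
Proof. by rewrite /facet -scalemxAl mxE. Qed.

Definition facetE := (facetD, facetN, facetZ).

Lemma facet_continuous M i : continuous (facet M i).
Proof.
have -> : facet M i = fun x => x 0 0 * M 0 i + x 0 1 * M 1 i.
  apply/funext => x; rewrite /facet mxE !big_ord_recl big_ord0 addr0.
  by congr (_ + x _ _ * M _ _); apply: val_inj.
move=> x.
have c0 : (fun y : 'rV[R]_2 => y 0 0) @ x --> x 0 0 by exact: coord_continuous.
have c1 : (fun y : 'rV[R]_2 => y 0 1) @ x --> x 0 1 by exact: coord_continuous.
exact: (cvgD (cvgM c0 (cvg_cst _)) (cvgM c1 (cvg_cst _))).
Qed.

(** The barycentric coordinates with respect to the vertices of S. *)
Definition bary M i x : R := (1 - facet M i x) / 3.

(** H is the vector of support values of K in the three facet directions, and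
    k i is a point of K at which the i-th one is attained. *)
Definition support_points M (K : set 'rV[R]_2) (H : 'I_3 -> R)
    (k : 'I_3 -> 'rV[R]_2) : Prop :=
  forall i, [/\ K (k i), facet M i (k i) = H i &
                forall x, K x -> facet M i x <= H i].

(** S is cut out by the facet functionals, normalised to be 1 on the facets.
    That they add up to 0 says that the centroid of S is the origin. *)
Record gauge_frame (S : set 'rV[R]_2) M : Prop := GaugeFrame {
  frame_sum0 : forall x, \sum_i facet M i x = 0 ;
  frame_onto : forall a : 'I_3 -> R, \sum_i a i = 0 ->
    exists x, forall i, facet M i x = a i ;
  frame_inj : forall x y, (forall i, facet M i x = facet M i y) -> x = y ;
  frame_set : S = [set x | forall i, facet M i x <= 1]
}.

End Functionals.

(** * Radii and diameter from support values *)

(** The polynomial is trilinear, so its minimum on the box is attained at a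
    corner; with two variables equal to d and one to 1 - d it is d (1 - d), and
    the difference factors through the side 2 d - 1 of the box. *)
Lemma triangle_ratio_ge (R : realType) (a b c d : R) :
  1 - d <= a <= d -> 1 - d <= b <= d -> 1 - d <= c <= d ->
  d * (1 - d) <= a * b * c + (1 - a) * (1 - b) * (1 - c).
Proof.
move=> /andP[a0 a1] /andP[b0 b1] /andP[c0 c1].
have [w0|w0] := leP (2 * d - 1) 0.
  have -> : d = 1 / 2 by lra.
  have -> : a = 1 / 2 by lra.
  have -> : b = 1 / 2 by lra.
  have -> : c = 1 / 2 by lra.
  by lra.
(* Both triples of factors below are nonnegative on the box; the identity is
   the expansion of a trilinear polynomial from its values at the corners. *)
rewrite -subr_ge0 -(pmulr_rge0 _ w0).
rewrite [leRHS](_ : _ = (a - (1 - d)) * (b - (1 - d)) * (c - (1 - d)) +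
  (d - a) * (d - b) * (d - c)); last by ring.
by rewrite addr_ge0// !mulr_ge0// subr_ge0.
Qed.

Section Frame.
Context {R : realType} {S : set 'rV[R]_2} {M : 'M[R]_(2, 3)}.
Hypothesis frM : gauge_frame S M.
Implicit Types (K : set 'rV[R]_2) (x y t : 'rV[R]_2) (i : 'I_3) (l rho : R).

Local Notation h := (facet M).

Lemma frame_dilate l x : 0 <= l -> dilate l S x <-> forall i, h i x <= l.
Proof.
rewrite le_eqVlt => /predU1P[<-|l_gt0].
(* For l = 0 the three bounds h i x <= 0 force x = 0, since the sum is 0. *)
- split=> [[y _ <-] i|hx]; first by rewrite facetZ mul0r.
  exists 0.
    by rewrite (frame_set frM) => i; rewrite -(scale0r 0) facetZ mul0r.
  apply: (frame_inj frM); have := frame_sum0 frM x; rewrite sum_ord3.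
  have := hx 0; have := hx 1; have := hx 2.
  by move=> ? ? ? ?; apply: ord3P; rewrite facetZ mul0r; lra.
- rewrite (frame_set frM); split=> [[y /= Sy <-] i|hx].
    by rewrite facetZ ger_pMr.
  exists (l^-1 *: x) => [i|]; last by rewrite scalerA divff ?gt_eqF// scale1r.
  by rewrite facetZ mulrC ler_pdivrMr// mul1r.
Qed.

(** Homothets of S are exactly the triangles bounded by the same three facet
    directions, which turns inclusions of copies into inequalities. *)
Lemma frame_copy t rho x : 0 <= rho ->
  translate t (dilate rho S) x <-> forall i, h i x <= h i t + rho.
Proof.
move=> rho0; split=> [[y /(frame_dilate _ rho0) hy <-] i|hx].
  by rewrite facetD lerD2l.
exists (x - t); last by rewrite addrC subrK.
by apply/frame_dilate => // i; rewrite !facetE lerBlDl.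
Qed.

Lemma frame_gauge_le x l : gauge S x <= l <-> forall i, h i x <= l.
Proof.
have E : [set l | 0 <= l /\ dilate l S x] =
         [set l | 0 <= l /\ forall i, h i x <= l].
  by apply/seteqP; split=> m [m0 /(frame_dilate _ m0)].
rewrite /gauge E; split=> [gl i|hx].
  apply: le_trans gl; apply: lb_le_inf => [|m [_]//].
  exists (\sum_i `|h i x|); split=> [|j]; first exact: sumr_ge0.
  rewrite (bigD1 j)//=; apply: le_trans (ler_norm _) _.
  by rewrite lerDl sumr_ge0.
apply: ge_inf; first by exists 0 => m [].
split=> //; have := frame_sum0 frM x; rewrite sum_ord3.
by have := hx 0; have := hx 1; have := hx 2; lra.
Qed.

(** The j-th vertex of t + rho S lies on the two facets other than the j-th, so
    h j is smallest there. *)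
Lemma copy_vertices t rho : 0 <= rho ->
  exists q : 'I_3 -> 'rV[R]_2,
    (forall j, translate t (dilate rho S) (q j)) /\
    (forall j i, h i (q j) = h i t + rho - (if i == j then 3 * rho else 0)).
Proof.
move=> rho0.
have E j : exists x, forall i,
    h i x = h i t + rho - (if i == j then 3 * rho else 0).
  apply: (frame_onto frM); rewrite big_split/= sumrN -big_mkcond big_pred1_eq.
  by rewrite big_split/= (frame_sum0 frM) sumr_const card_ord; lra.
have [q hq] := choice E; exists q; split=> // j.
apply/frame_copy => // i; rewrite hq lerBlDr lerDl.
by case: ifP => _ //; rewrite mulr_ge0.
Qed.

Lemma degenerate_copy t : translate t (dilate 0 S) `<=` [set t].
Proof.
move=> x /frame_copy => /(_ (lexx _)) hx.
have := frame_sum0 frM x; have := frame_sum0 frM t; rewrite !sum_ord3.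
have := hx 0; have := hx 1; have := hx 2 => ? ? ? ? ?.
by apply: (frame_inj frM); apply: ord3P; lra.
Qed.

Lemma support_points_exist K : convex_body K ->
  exists H k, support_points M K H k.
Proof.
move=> [K0 cK _].
have E i : exists c, K c /\ forall x, K x -> h i x <= h i c.
  have := @EVT_max_rV _ _ (h i) K K0 cK.
  case=> [|c /set_mem Kc maxc].
    by apply: continuous_subspaceT; exact: facet_continuous.
  by exists c; split=> // x Kx; apply: maxc; rewrite inE.
have [k kP] := choice E.
by exists (fun i => h i (k i)), k => i; have [] := kP i.
Qed.

Section SupportPoints.
Variables (K : set 'rV[R]_2) (H : 'I_3 -> R) (k : 'I_3 -> 'rV[R]_2).
Hypotheses (cK : convex_set (K : set (convex_lmodType 'rV[R]_2)))
  (supK : support_points M K H k).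

Let Kk i : K (k i). Proof. by have [] := supK i. Qed.
Let hk i : h i (k i) = H i. Proof. by have [] := supK i. Qed.
Let hH i x : K x -> h i x <= H i. Proof. by have [_ _] := supK i; apply. Qed.

Lemma sum_support_ge0 : 0 <= \sum_i H i.
Proof.
have := frame_sum0 frM (k 0); rewrite !sum_ord3.
by have := hH 0 (Kk 0); have := hH 1 (Kk 0); have := hH 2 (Kk 0); lra.
Qed.

(** The smallest homothet of S containing K touches K on all three facets, and
    translations change the facet levels by an arbitrary vector of sum 0, so only
    the sum of the support values matters. *)
Lemma frame_circumradius : circumradius K S = (\sum_i H i) / 3.
Proof.
have HS := sum_support_ge0.
set rad := _ / 3; have rad0 : 0 <= rad by rewrite divr_ge0.
have [|t ht] := frame_onto frM (a := fun i => H i - rad).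
  by rewrite /rad !sum_ord3; lra.
have Kt : K `<=` translate t (dilate rad S).
  by move=> x Kx; apply/frame_copy => // i; rewrite ht subrK hH.
apply/eqP; rewrite eq_le; apply/andP; split.
  by apply: ge_inf; [exists 0 => m []|split=> //; exists t].
apply: lb_le_inf => [|rho [rho0 [v Kv]]].
  by exists rad; split=> //; exists t.
have := frame_sum0 frM v; rewrite /rad !sum_ord3.
have E i : H i <= h i v + rho.
  by rewrite -hk; exact: (frame_copy v (k i) rho0).1 (Kv _ (Kk i)) i.
by have := E 0; have := E 1; have := E 2; lra.
Qed.

Lemma copy_le_support t rho : 0 <= rho ->
  translate t (dilate rho S) `<=` K ->
  forall i, h i t + rho <= H i.
Proof.
(* h i is maximal on the copy at any vertex but the i-th. *)
move=> rho0 tK i; have [q [qS hq]] := copy_vertices t rho0.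
have iN : (i == i + 1) = false by move: (i); exact: ord3P.
by have := hH i (tK _ (qS (i + 1))); rewrite hq iN subr0.
Qed.

Lemma frame_inradius_ge t rho : 0 <= rho ->
  translate t (dilate rho S) `<=` K -> rho <= inradius K S.
Proof.
move=> rho0 tK; apply: ub_le_sup; last by split=> //; exists t.
exists ((\sum_i H i) / 3) => m [m0 [u /(copy_le_support m0) uH]].
have := frame_sum0 frM u; rewrite !sum_ord3.
by have := uH 0; have := uH 1; have := uH 2; lra.
Qed.

Lemma frame_inradius_le rho :
  (forall t l, 0 <= l -> translate t (dilate l S) `<=` K -> l <= rho) ->
  inradius K S <= rho.
Proof.
move=> le_rho; apply: ge_sup => [|l [l0 [t]]]; last exact: le_rho.
by exists 0; split=> //; exists (k 0) => x /degenerate_copy ->.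
Qed.

Lemma frame_inradius_ge0 : 0 <= inradius K S.
Proof. by apply: (@frame_inradius_ge (k 0)) => // x /degenerate_copy ->. Qed.

(** Since the functionals add up to 0, - h i y is the sum of the other two
    functionals at y, each bounded by its support value. *)
Lemma width_le_sum i x y : K x -> K y -> h i x - h i y <= \sum_i H i.
Proof.
move=> Kx Ky; have := frame_sum0 frM y; rewrite !sum_ord3.
have := hH 0 Ky; have := hH 1 Ky; have := hH 2 Ky => ? ? ? ?.
by move: i (hH i Kx); apply: ord3P; lra.
Qed.

Lemma frame_diam_le l :
  (forall x y i, K x -> K y -> h i x - h i y <= l) -> diam_MIN K S <= l.
Proof.
move=> hl; apply: ge_sup => [|_ [x Kx [y Ky <-]]].
  by exists (gauge S (k 0 - k 0)); exists (k 0) => //; exists (k 0).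
by apply/frame_gauge_le => i; rewrite !facetE; exact: hl.
Qed.

Lemma frame_diam_ge x y i : K x -> K y -> h i x - h i y <= diam_MIN K S.
Proof.
move=> Kx Ky; apply: (@le_trans _ _ (gauge S (x - y))).
  by rewrite -facetN -facetD; exact: (frame_gauge_le _ _).1 (lexx _) i.
apply: ub_le_sup; last by exists x => //; exists y.
exists (\sum_i H i) => _ [u Ku [v Kv <-]]; apply/frame_gauge_le => j.
by rewrite !facetE width_le_sum.
Qed.

(** S is the convex hull of its vertices, with barycentric weights
    (1 - h j y) / 3; working with y in S covers rho = 0 as well. *)
Lemma frame_copy_sub t rho (q : 'I_3 -> 'rV[R]_2) :
  (forall j, K (q j)) ->
  (forall j i, h i (q j) = h i t + rho - (if i == j then 3 * rho else 0)) ->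
  translate t (dilate rho S) `<=` K.
Proof.
move=> Kq hq _ [_ [y Sy <-] <-]; rewrite (frame_set frM) in Sy.
suff -> : t + rho *: y = \sum_j ((1 - h j y) / 3) *: q j.
  apply: convex_set3 => // [j|]; first by rewrite divr_ge0// subr_ge0.
  by have := frame_sum0 frM y; rewrite !sum_ord3; lra.
apply: (frame_inj frM); have := frame_sum0 frM y; rewrite !sum_ord3 => y0.
have y2 : h 2 y = - h 0 y - h 1 y by lra.
by apply: ord3P; rewrite !facetE !hq/= y2; field.
Qed.

(** If the support values add up to 0, every point of K attains all three, and
    the functionals separate points. *)
Lemma frame_support_gt0 : ~ (exists x, K = [set x]) -> 0 < \sum_i H i.
Proof.
move=> nK; rewrite lt_neqAle sum_support_ge0 andbT; apply/eqP => H0; apply: nK.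
have hE x i : K x -> h i x = H i.
  move=> Kx; move: H0 (frame_sum0 frM x); rewrite !sum_ord3.
  have := hH 0 Kx; have := hH 1 Kx; have := hH 2 Kx.
  by move=> ? ? ? ? ?; move: i; apply: ord3P; lra.
exists (k 0); apply/seteqP; split=> [x Kx|x -> //].
by apply: (frame_inj frM) => i; rewrite !hE.
Qed.

(** The levels h i t - H i of the centre of a copy add up to - 3 R, so one of
    them is at most - R; the i-th vertex of the copy is 2 rho lower still, and
    the width of K in that direction is at least R + 2 rho. *)
Lemma frame_inradius_diam :
  2 * inradius K S + circumradius K S <= diam_MIN K S.
Proof.
suff : inradius K S <= (diam_MIN K S - circumradius K S) / 2 by lra.
apply: frame_inradius_le => t rho rho0 tK.
have [i ti] : exists i, h i t - H i <= - circumradius K S.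
  apply: contrapT => /forallNP gtR; have := frame_sum0 frM t.
  have E i : - circumradius K S < h i t - H i.
    by rewrite ltNge; apply/negP; exact: gtR.
  have := E 0; have := E 1; have := E 2.
  by rewrite frame_circumradius !sum_ord3; lra.
have [q [qS hq]] := copy_vertices t rho0.
have := frame_diam_ge i (Kk i) (tK _ (qS i)).
by rewrite hk hq eqxx; lra.
Qed.

Lemma frame_diam_circumradius : diam_MIN K S <= 3 * circumradius K S.
Proof.
rewrite frame_circumradius; apply: frame_diam_le => x y i Kx Ky.
by have := width_le_sum i Kx Ky; lra.
Qed.

(** In barycentric coordinates (H i - h i) / s of the circumscribed copy of S,
    the points k are (0, a, 1 - a), (1 - b, 0, b) and (c, 1 - c, 0).  The largest
    copy of S in the triangle that they span has its vertices on the three edges;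
    solving for them gives the points q below, and the size of that copy,
    relative to the circumscribed one, is the determinant of the three
    coordinate vectors. *)
Lemma touching_triangle_inradius (a b c s : R) :
  0 <= a <= 1 -> 0 <= b <= 1 -> 0 <= c <= 1 -> s = \sum_i H i ->
  h 1 (k 0) = H 1 - s * a -> h 2 (k 0) = H 2 - s * (1 - a) ->
  h 2 (k 1) = H 2 - s * b -> h 0 (k 1) = H 0 - s * (1 - b) ->
  h 0 (k 2) = H 0 - s * c -> h 1 (k 2) = H 1 - s * (1 - c) ->
  s / 3 * (a * b * c + (1 - a) * (1 - b) * (1 - c)) <= inradius K S.
Proof.
move=> a01 b01 c01 sE h10 h20 h21 h01 h02 h12.
set D := _ + _.
have s0 : 0 <= s by rewrite sE sum_support_ge0.
have D0 : 0 <= D.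
  move: a01 b01 c01 => /andP[a0 a1] /andP[b0 b1] /andP[c0 c1].
  by rewrite /D addr_ge0// !mulr_ge0// subr_ge0.
(* The triple holds the smallest barycentric coordinates on the copy. *)
have [t ht] : exists t, forall i, h i t =
    H i - s * triple (c * (1 - b)) (a * (1 - c)) (b * (1 - a)) i - s / 3 * D.
  apply: (frame_onto frM); move: sE; rewrite !sum_ord3 /triple/= => sE.
  by rewrite /D; rewrite sE; field.
apply: (@frame_inradius_ge t); first by rewrite mulr_ge0 ?divr_ge0.
move/convex_setP : cK => cvK.
pose q := triple ((1 - a) *: k 1 + (1 - (1 - a)) *: k 2)
  (b *: k 0 + (1 - b) *: k 2) ((1 - c) *: k 0 + (1 - (1 - c)) *: k 1).
apply: (@frame_copy_sub _ _ q).
  by apply: ord3P; rewrite /q /triple/=; apply: cvK => //; lra.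
apply: ord3P; apply: ord3P;
  rewrite ht /q /triple/= !facetE ?h10 ?h20 ?h21 ?h01 ?h02 ?h12 ?hk /D;
  by field.
Qed.

(** The three points where K touches its circumscribed copy of S already span a
    triangle with a large enough inradius. *)
Lemma frame_diam_inradius : 0 < \sum_i H i ->
  diam_MIN K S / (3 * circumradius K S) *
    (1 - diam_MIN K S / (3 * circumradius K S))
  <= inradius K S / circumradius K S.
Proof.
rewrite frame_circumradius mulrCA divff ?mulr1//; set s := \sum_i H i => s0.
have uD i j : (H i - h i (k j)) / s <= diam_MIN K S / s.
  by rewrite ler_pM2r ?invr_gt0// -hk frame_diam_ge.
have u0 i j : 0 <= (H i - h i (k j)) / s.
  by rewrite divr_ge0 ?subr_ge0 ?hH// ltW.
have usum j : \sum_i (H i - h i (k j)) / s = 1.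
  rewrite -mulr_suml sumrB (frame_sum0 frM) subr0 divff//.
  by rewrite gt_eqF.
have uE i j : h i (k j) = H i - s * ((H i - h i (k j)) / s).
  by field; rewrite gt_eqF.
have := usum 0; have := usum 1; have := usum 2; rewrite !sum_ord3 !hk !subrr.
rewrite !mul0r => u2 u1 u0'.
set d := _ / s; set a := (H 1 - h 1 (k 0)) / s.
set b := (H 2 - h 2 (k 1)) / s; set c := (H 0 - h 0 (k 2)) / s.
have aE : (H 2 - h 2 (k 0)) / s = 1 - a by rewrite /a; lra.
have bE : (H 0 - h 0 (k 1)) / s = 1 - b by rewrite /b; lra.
have cE : (H 1 - h 1 (k 2)) / s = 1 - c by rewrite /c; lra.
(* The coordinates of k 0 are 0, a and 1 - a, all at most d, so a >= 1 - d as
   well; likewise for b and c. *)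
have ad : 1 - d <= a <= d
  by have := uD 2 0; have := uD 1 0; rewrite aE -/a -/d; lra.
have bd : 1 - d <= b <= d
  by have := uD 0 1; have := uD 2 1; rewrite bE -/b -/d; lra.
have cd : 1 - d <= c <= d
  by have := uD 1 2; have := uD 0 2; rewrite cE -/c -/d; lra.
have a01 : 0 <= a <= 1 by have := u0 2 0; have := u0 1 0; rewrite aE -/a; lra.
have b01 : 0 <= b <= 1 by have := u0 0 1; have := u0 2 1; rewrite bE -/b; lra.
have c01 : 0 <= c <= 1 by have := u0 1 2; have := u0 0 2; rewrite cE -/c; lra.
rewrite ler_pdivlMr ?divr_gt0// mulrC.
apply: (@le_trans _ _ (s / 3 * (a * b * c + (1 - a) * (1 - b) * (1 - c)))).
  by rewrite ler_pM2l ?divr_gt0// triangle_ratio_ge.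
apply: touching_triangle_inradius => //.
- by rewrite -aE -uE.
- by rewrite -bE -uE.
- by rewrite -cE -uE.
Qed.

End SupportPoints.
End Frame.

(** * Truncated hexagons *)

Section PolygonDefinition.
Context {R : realType}.
Implicit Types (M : 'M[R]_(2, 3)) (d e rho : R).

(** The hexagon of points of S with barycentric coordinates at most d, truncated
    parallel to a side of S by the bound g, and by a second line, of level e.
    That line is parallel to the chord from (0, d, 1 - d) to (1 - d, 0, d), at
    both ends of which the form has the value d (1 - d). *)
Definition polygon M d g e : set 'rV[R]_2 :=
  [set x | [/\ forall i, 0 <= bary M i x <= d, bary M 0 x <= g &
               e <= d * bary M 0 x + (1 - d) * bary M 1 x]].

(** Here v lists the smallest barycentric coordinates on a copy of S of size rho;
    the vertices of the copy are v plus rho times the unit vectors. *)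
Definition copy_fits d g e (v : 'I_3 -> R) rho : Prop :=
  [/\ \sum_i v i + rho = 1, forall i, 0 <= v i /\ v i + rho <= d,
      v 0 + rho <= g & e <= d * v 0 + (1 - d) * v 1].

End PolygonDefinition.

Section Polygon.
Context {R : realType} {S : set 'rV[R]_2} {M : 'M[R]_(2, 3)}.
Hypothesis frM : gauge_frame S M.
Implicit Types (x t : 'rV[R]_2) (i : 'I_3) (d g e rho : R).

Local Notation h := (facet M).
Local Notation u := (bary M).

Lemma bary_sum x : \sum_i u i x = 1.
Proof. by have := frame_sum0 frM x; rewrite !sum_ord3 /bary; lra. Qed.

Lemma bary_continuous i : continuous (u i).
Proof.
move=> x; have hx : facet M i @ x --> facet M i x by exact: facet_continuous.
exact: (cvgM (cvgB (cvg_cst _) hx) (cvg_cst _)).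
Qed.

Lemma bary_onto (w : 'I_3 -> R) : \sum_i w i = 1 ->
  exists x, forall i, u i x = w i.
Proof.
rewrite sum_ord3 => w1.
have [|x hx] := frame_onto frM (a := fun i => 1 - 3 * w i).
  by rewrite sum_ord3; lra.
by exists x => i; rewrite /bary hx; field.
Qed.

(** The points p are the vertices of S; the formula bounds the norm on S. *)
Lemma bary_expansion : exists p : 'I_3 -> 'rV[R]_2,
  forall x, x = \sum_j u j x *: p j.
Proof.
have E j : exists x, forall i, u i x = (i == j)%:R.
  by apply: bary_onto; rewrite (bigD1 j)//= big1 ?addr0 ?eqxx// => i /negPf ->.
have [p bp] := choice E; exists p => x; apply: (frame_inj frM).
have hp i j : h i (p j) = 1 - 3 * (i == j)%:R by rewrite -bp /bary; field.
have := bary_sum x; rewrite !sum_ord3 /bary => bx.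
have x2 : h 2 x = - h 0 x - h 1 x by lra.
by apply: ord3P; rewrite !facetE !hp/= x2; field.
Qed.

Lemma polygon_convex d g e :
  convex_set (polygon M d g e : set (convex_lmodType 'rV[R]_2)).
Proof.
apply/convex_setP => x y l /andP[l0 l1] [xd x0 xe] [yd y0 ye].
have E i : u i (l *: x + (1 - l) *: y) = l * u i x + (1 - l) * u i y.
  by rewrite /bary !facetE; field.
split=> [i||]; rewrite !E.
- by have /andP[? ?] := xd i; have /andP[? ?] := yd i; nra.
- by nra.
- by nra.
Qed.

Lemma polygon_compact d g e : d <= 1 -> compact (polygon M d g e).
Proof.
move=> d1; apply: bounded_closed_compact.
  have [p xE] := bary_expansion.
  exists (\sum_j `|p j|); split; first exact: num_real.
  move=> m pm x [xd _ _]; apply: le_trans (ltW pm).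
  rewrite [x in `|x|]xE; apply: le_trans (ler_norm_sum _ _ _) _.
  apply: ler_sum => j _; rewrite normrZ ler_piMl//.
  by have /andP[? ?] := xd j; rewrite ger0_norm//; lra.
have -> : polygon M d g e =
    \bigcap_i (u i @^-1` [set z | 0 <= z] `&` u i @^-1` [set z | z <= d])
    `&` u 0 @^-1` [set z | z <= g]
    `&` (fun x => d * u 0 x + (1 - d) * u 1 x) @^-1` [set z | e <= z].
  apply/seteqP; split=> [x [xd x0 xe]|x [[xd x0] xe]].
    by do 2![split=> //] => i _; have /andP[] := xd i.
  by split=> // i; have [? ?] := xd i I; exact/andP.
have bary_closed i (A : set R) : closed A -> closed (u i @^-1` A).
  by move: A; apply/continuous_closedP; exact: bary_continuous.
apply: closedI; [apply: closedI|].
- apply: closed_bigI => i _.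
  by apply: closedI; apply: bary_closed; [exact: closed_ge|exact: closed_le].
- by apply: bary_closed; exact: closed_le.
- apply: (continuous_closedP _).1 _ _ (@closed_ge _ e) => x.
  have b0 : u 0 @ x --> u 0 x by exact: bary_continuous.
  have b1 : u 1 @ x --> u 1 x by exact: bary_continuous.
  exact: (cvgD (cvgM (cvg_cst _) b0) (cvgM (cvg_cst _) b1)).
Qed.

Lemma copy_sub_polygon d g e t rho : 0 <= d <= 1 -> 0 <= rho ->
  translate t (dilate rho S) `<=` polygon M d g e <->
  copy_fits d g e (fun i => u i t - rho / 3) rho.
Proof.
move=> /andP[d_ge0 d1] rho0; rewrite /copy_fits.
have := bary_sum t; rewrite !sum_ord3 => tsum.
split=> [tP|[_ vd v0 ve] x /(frame_copy frM _ _ rho0) hx].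
  have [q [qS hq]] := copy_vertices frM t rho0.
  have bq j i : u i (q j) = u i t - rho / 3 + (if i == j then rho else 0).
    by rewrite /bary hq; case: ifP => _; field.
  (* Each inequality is tested at the vertex of the copy where it is tightest. *)
  have [[q0d q00 _] [q1d _ _] [_ _ q2e]] :=
    And3 (tP _ (qS 0)) (tP _ (qS 1)) (tP _ (qS 2)).
  split; first by lra.
  - apply: ord3P.
    + by move: (q0d 0) (q1d 0); rewrite !bq/=; lra.
    + by move: (q0d 1) (q1d 1); rewrite !bq/=; lra.
    + by move: (tP _ (qS 2)) (q0d 2) => [/(_ 2) + _ _]; rewrite !bq/=; lra.
  - by move: q00; rewrite bq/=; lra.
  - by move: q2e; rewrite !bq/= !addr0.
have bx i : u i t - rho / 3 <= u i x.
  by have := hx i; rewrite /bary/=; lra.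
have := bary_sum x; rewrite sum_ord3 => xsum.
have [[? ?] [? ?] [? ?]] := And3 (vd 0) (vd 1) (vd 2).
have := bx 0; have := bx 1; have := bx 2 => ? ? ?.
split; [apply: ord3P; lra|lra|].
by apply: le_trans ve _; rewrite lerD// ler_wpM2l//; lra.
Qed.

(** The points k are the vertices (0, d, 1 - d), (1 - d, 0, d) and
    (1 - d, d, 0) of the hexagon, which survive the truncation.  One lies on each
    side of S, which fixes the circumradius to be 1, and the first two realise
    the greatest width in the direction of index 1. *)
Lemma polygon_support d g e : 1 / 2 <= d <= 1 -> 1 - d <= g ->
  e <= d * (1 - d) ->
  exists k : 'I_3 -> 'rV[R]_2,
    [/\ support_points M (polygon M d g e) (fun=> 1) k, u 1 (k 0) = d &
        u 1 (k 1) = 0].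
Proof.
move=> /andP[d2 d1] dg ed.
have dd : 0 <= d * (1 - d) by rewrite mulr_ge0; lra.
have [|A bA] := bary_onto (w := triple 0 d (1 - d)).
  by rewrite sum_ord3 /triple/=; lra.
have [|C bC] := bary_onto (w := triple (1 - d) 0 d).
  by rewrite sum_ord3 /triple/=; lra.
have [|F bF] := bary_onto (w := triple (1 - d) d 0).
  by rewrite sum_ord3 /triple/=; lra.
exists (triple A C F); split; [move=> i|by rewrite bA|by rewrite bC].
have h1 x : u i x = 0 -> h i x = 1 by rewrite /bary; lra.
split; last by move=> x [/(_ i)/andP[+ _] _ _]; rewrite /bary/=; lra.
  move: i {h1}; apply: ord3P; split;
    rewrite /triple/= ?bA ?bC ?bF /triple/=; try lra.
  - by apply: ord3P; rewrite bA /triple/=; lra.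
  - by apply: ord3P; rewrite bC /triple/=; lra.
  - by apply: ord3P; rewrite bF /triple/=; lra.
by move: i h1; apply: ord3P => h1; rewrite /triple/=; apply: h1;
  rewrite ?bA ?bC ?bF.
Qed.

End Polygon.

(** * Bodies attaining prescribed radii and diameter *)

Section Extremal.
Context {R : realType}.
Implicit Types (d x : R).

(** For small x the oblique cut decides: with g = 1 - d, the bounds on v 0 and
    v 1 give d v 0 + (1 - d) v 1 <= 2 d (1 - d) - rho, so the level
    e = 2 d (1 - d) - x leaves room for size x and no more.  For larger x that
    cut is dropped (e = 0), and the size is limited by g itself and by
    1 + 2 rho <= g + 2 d, the sum of the three upper bounds; g is chosen so that
    the stricter of the two reads rho <= x. *)
Lemma tight_fit d x :
  1 / 2 <= d <= 1 -> d * (1 - d) <= x -> 2 * x + 1 <= 3 * d ->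
  exists g e v, [/\ 1 - d <= g, e <= d * (1 - d), copy_fits d g e v x &
    forall v' rho, copy_fits d g e v' rho -> rho <= x].
Proof.
move=> /andP[d2 d1] dx xd.
have dd : 0 <= d * (1 - d) by rewrite mulr_ge0; lra.
have [/andP[xd1 xd2]|] := boolP ((x <= 1 - d) && (2 * x <= d)).
  exists (1 - d), (2 * (d * (1 - d)) - x), (triple (1 - d - x) (d - x) x).
  split; [by []|lra| |].
    split; rewrite ?sum_ord3 /triple/=; [lra| |lra|nra].
    by apply: ord3P; rewrite /=; lra.
  move=> v rho [_ vd v0 ve].
  have [_ v1] := vd 1.
  have m0 : 0 <= d * (1 - d - rho - v 0) by rewrite mulr_ge0; lra.
  have m1 : 0 <= (1 - d) * (d - rho - v 1) by rewrite mulr_ge0; lra.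
  by lra.
rewrite negb_and -!ltNge => xbig.
have dx' : 1 - d <= Num.max x (2 * x + 1 - 2 * d).
  by rewrite le_max; case/orP: xbig => ?; apply/orP; [left|right]; lra.
have [le_x|lt_x] := leP x (2 * x + 1 - 2 * d).
  exists (2 * x + 1 - 2 * d), 0, (triple (x + 1 - 2 * d) (d - x) (d - x)).
  split; [|by []| |].
  - by move: dx'; rewrite max_r.
  - split; rewrite ?sum_ord3 /triple/=; [lra| |lra|].
      by apply: ord3P; rewrite /=; lra.
    by rewrite addr_ge0// mulr_ge0; lra.
  - move=> v rho []; rewrite sum_ord3 => ? vd ? _.
    by have [_ ?] := vd 1; have [_ ?] := vd 2; lra.
exists x, 0, (triple 0 ((1 - x) / 2) ((1 - x) / 2)).
split; [|by []| |].
- by move: dx'; rewrite max_l// ltW.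
- split; rewrite ?sum_ord3 /triple/=; [lra| |lra|].
    by apply: ord3P; rewrite /=; lra.
  by rewrite addr_ge0// mulr_ge0; lra.
- by move=> v rho [_ vd ? _]; have [? _] := vd 0; lra.
Qed.

Lemma extremal_body (S : set 'rV[R]_2) (M : 'M[R]_(2, 3)) d x :
  gauge_frame S M ->
  1 / 2 <= d <= 1 -> d * (1 - d) <= x -> 2 * x + 1 <= 3 * d ->
  exists K : set 'rV[R]_2, [/\ nonsingleton_body K, inradius K S = x,
    circumradius K S = 1 & diam_MIN K S = 3 * d].
Proof.
move=> frM d21 dx xd; have [g [e [v [dg ed vx maxx]]]] := tight_fit d21 dx xd.
have [k [supk k0 k1]] := polygon_support frM d21 dg ed.
case/andP: d21 => d2 d1.
have x0 : 0 <= x by apply: le_trans dx; rewrite mulr_ge0; lra.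
have d01 : 0 <= d <= 1 by lra.
have kP i : polygon M d g e (k i) by have [] := supk i.
exists (polygon M d g e); split.
- split; first split.
  + by exists (k 0).
  + exact: (polygon_compact frM).
  + exact: polygon_convex.
  + move=> [y Ky]; have := kP 0; have := kP 1; rewrite Ky => k1y k0y.
    by move: k0; rewrite k0y -k1y k1; lra.
- apply/eqP; rewrite eq_le; apply/andP; split.
    apply: (frame_inradius_le frM supk) => t rho rho0.
    by move/(copy_sub_polygon frM _ _ _ d01 rho0) => /maxx.
  have [t vt] : exists t, forall i, bary M i t = v i + x / 3.
    apply: (bary_onto frM); case: vx => vx _ _ _.
    by rewrite !sum_ord3 in vx *; lra.
  apply: (frame_inradius_ge frM supk (t := t)) => //.
  apply/(copy_sub_polygon frM) => //; congr copy_fits: vx.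
  by apply/funext => i; rewrite vt addrK.
- by rewrite (frame_circumradius frM supk) sum_ord3; lra.
- apply/eqP; rewrite eq_le; apply/andP; split.
    apply: (frame_diam_le frM supk) => y z i [yd _ _] [zd _ _].
    by have /andP[] := yd i; have /andP[] := zd i; rewrite /bary; lra.
  have := frame_diam_ge frM supk 1 (kP 1) (kP 0).
  by move: k0 k1; rewrite /bary; lra.
Qed.

End Extremal.

(** * Facet functionals from the vertices *)

Section CenteredTriangle.
Context {R : realType}.
Implicit Types (S : set 'rV[R]_2) (M : 'M[R]_(2, 3)).

Lemma free2_coordinates (p q : 'rV[R]_2) : free [:: p; q] ->
  exists L : 'M[R]_2, [/\ p *m L = delta_mx 0 0, q *m L = delta_mx 0 1 &
    forall x, x = (x *m L) 0 0 *: p + (x *m L) 0 1 *: q].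
Proof.
move=> fpq.
pose B : 'M[R]_2 := \matrix_(i, j) (if i == 0 then p 0 j else q 0 j).
have vB (v : 'rV_2) : v *m B = v 0 0 *: p + v 0 1 *: q.
  apply/rowP => j; rewrite !mxE !big_ord_recl big_ord0 addr0 !mxE /=.
  by congr (_ + v _ _ * _); apply: val_inj.
have uB : B \in unitmx.
  rewrite -row_free_unit; apply: inj_row_free => v; rewrite vB => v0.
  have /freeP/(_ (fun i => v 0 i)) := fpq : free [tuple p; q].
  rewrite !big_ord_recl big_ord0 /= addr0.
  rewrite (_ : lift ord0 ord0 = 1); last exact: val_inj.
  by move=> /(_ v0) vi; apply/rowP => i; rewrite vi mxE.
exists (invmx B); split.
- apply: (can_inj (mulmxK uB)); rewrite mulmxKV// vB !mxE /=.
  by rewrite scale1r scale0r addr0.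
- apply: (can_inj (mulmxK uB)); rewrite mulmxKV// vB !mxE /=.
  by rewrite scale1r scale0r add0r.
- by move=> x; rewrite -vB mulmxKV.
Qed.

(** The edges b - a and c - a serve as a basis, and M sends them to (3, -3, 0)
    and (3, 0, -3), so that h i drops by 3 from the other two vertices to the
    i-th.  The facet levels c depend on where the origin is; the frame itself is
    that of the translate of S with centroid 0. *)
Lemma triangle_halfplanes S : triangle S ->
  exists (M : 'M[R]_(2, 3)) (c : 'I_3 -> R) (p : 'I_3 -> 'rV[R]_2),
  [/\ gauge_frame [set x | forall i, facet M i x <= 1] M,
      S = [set x | forall i, facet M i x <= c i],
      forall j, S (p j) &
      forall i j, facet M i (p j) = c i - (if i == j then 3 else 0)].
Proof.
move=> [a [b [c [/free2_coordinates[L [La Lb Lx]] SE]]]].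
pose N : 'M[R]_(2, 3) := \matrix_(i, j)
  triple 3 (if i == 0 then - 3 else 0) (if i == 0 then 0 else - 3) j.
pose M := L *m N.
have hE i x : facet M i x = (x *m L) 0 0 * N 0 i + (x *m L) 0 1 * N 1 i.
  rewrite /facet /M mulmxA mxE !big_ord_recl big_ord0 addr0.
  by congr (_ + (_ *m _) _ _ * N _ _); apply: val_inj.
have h0 x : facet M 0 x = 3 * ((x *m L) 0 0 + (x *m L) 0 1).
  by rewrite hE !mxE /triple/=; ring.
have h1 x : facet M 1 x = - 3 * (x *m L) 0 0.
  by rewrite hE !mxE /triple/=; ring.
have h2 x : facet M 2 x = - 3 * (x *m L) 0 1.
  by rewrite hE !mxE /triple/=; ring.
have hba i : facet M i (b - a) = N 0 i by rewrite hE La !mxE /=; ring.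
have hca i : facet M i (c - a) = N 1 i by rewrite hE Lb !mxE /=; ring.
have frM : gauge_frame [set x | forall i, facet M i x <= 1] M.
  split=> // [x|w|x y hxy].
  - by rewrite sum_ord3 h0 h1 h2; ring.
  - rewrite sum_ord3 => w0.
    exists ((- w 1 / 3) *: (b - a) + (- w 2 / 3) *: (c - a)).
    by apply: ord3P; rewrite facetD !facetZ hba hca !mxE /triple/=; lra.
  - rewrite [x]Lx [y]Lx; congr (_ *: _ + _ *: _).
      by have := hxy 1; rewrite !h1; lra.
    by have := hxy 2; rewrite !h2; lra.
pose p := triple a b c.
pose k i := facet M i (p i) + 3.
have hab i : facet M i b = facet M i a + N 0 i.
  by rewrite -hba -facetD addrC subrK.
have hac i : facet M i c = facet M i a + N 1 i.
  by rewrite -hca -facetD addrC subrK.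
have hp i j : facet M i (p j) = k i - (if i == j then 3 else 0).
  move: i j; apply: ord3P; apply: ord3P;
    rewrite /k /p /triple/= ?hab ?hac ?mxE /triple/=; lra.
exists M, k, p.
have abc j : [set a; b; c] (p j).
  by move: j; apply: ord3P; rewrite /p /triple/=; tauto.
have Sp j : S (p j) by rewrite SE; exact: sub_gen_smallest.
split=> //.
have ksum : \sum_i k i = 3.
  by have := frame_sum0 frM (p 0); rewrite !sum_ord3 !hp/=; lra.
rewrite {1}SE; apply/seteqP; split.
  apply: smallest_sub.
    apply/convex_setP => x y l /andP[l0 l1] hx hy i.
    by rewrite !facetE; have := hx i; have := hy i; nra.
  have kp j i : facet M i (p j) <= k i by rewrite hp lerBlDr lerDl; case: ifP.
  by move=> _ [[->|->]|->]; [exact: (kp 0)|exact: (kp 1)|exact: (kp 2)].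
move=> x hx A [cA sA].
suff -> : x = \sum_j ((k j - facet M j x) / 3) *: p j.
  apply: convex_set3 => //.
  - by move=> j; exact: sA.
  - by move=> j; rewrite divr_ge0// subr_ge0.
  - by move: ksum (frame_sum0 frM x); rewrite !sum_ord3; lra.
have hx0 := frame_sum0 frM x.
rewrite !sum_ord3 in ksum hx0 *.
have k2 : k 2 = 3 - k 0 - k 1 by lra.
have x2 : facet M 2 x = - facet M 0 x - facet M 1 x by lra.
by apply: (frame_inj frM); apply: ord3P; rewrite !facetE !hp/= x2 k2; field.
Qed.

(** A vertex p j of S equals - s y for some y in S, where s is the asymmetry.
    Applying h j gives c j - 3 >= - s c j, hence c j >= 3 / (1 + s).  As s <= 2,
    all levels are at least 1; they add up to 3, so they are equal to 1. *)
Lemma centered_triangle_frame S : triangle S -> minkowski_centered S ->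
  exists M, gauge_frame S M.
Proof.
move=> /triangle_halfplanes[M [c [p [frM SE Sp hp]]]] cS.
have csum : c 0 + c 1 + c 2 = 3.
  by have := frame_sum0 frM (p 0); rewrite sum_ord3 !hp/=; lra.
pose rhos := [set rho : R | 0 <= rho /\
  exists t, S `<=` translate t (dilate rho (dilate (-1) S))].
(* Reflecting S in its centroid and doubling gives a triangle containing S. *)
have rhos2 : rhos 2.
  split=> //; exists (\sum_i p i) => x; rewrite {1}SE => hx.
  exists (2 *: (-1 *: (2^-1 *: (\sum_i p i - x)))).
    exists (-1 *: (2^-1 *: (\sum_i p i - x))) => //.
    exists (2^-1 *: (\sum_i p i - x)) => //.
    have := frame_sum0 frM x; rewrite SE !sum_ord3 => hx0.
    have := hx 0; have := hx 1; have := hx 2 => ? ? ?.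
    by apply: ord3P; rewrite !facetE !hp/=; lra.
  by rewrite !scalerA mulrN1 mulNr divff// scaleN1r opprB addrC subrK.
have s2 : asymmetry S <= 2 by apply: ge_inf => //; exists 0 => m [].
have s0 : 0 <= asymmetry S by apply: lb_le_inf => [|m []//]; exists 2.
have c_ge1 j : 1 <= c j.
  have [y Sy] := cS _ (Sp j); rewrite SE in Sy.
  move=> /(congr1 (facet M j)); rewrite facetZ hp eqxx => yE.
  have : asymmetry S * facet M j y <= asymmetry S * c j by rewrite ler_wpM2l.
  clear SE => sy; rewrite leNgt; apply/negP => c1.
  have : 0 < (1 + asymmetry S) * (1 - c j) by rewrite mulr_gt0; lra.
  by lra.
exists M; case: frM => f0 fonto finj _; split=> //.
rewrite SE; suff c1 i : c i = 1.
  by apply/seteqP; split=> x hx i; have := hx i; rewrite c1.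
have := c_ge1 0; have := c_ge1 1; have := c_ge1 2 => ? ? ?.
by move: i; apply: ord3P; lra.
Qed.

End CenteredTriangle.

Theorem corollary6p5 (R : realType) (S : set 'rV[R]_2)
    (hS : triangle S) (hcent : minkowski_centered S) :
  (forall K : set 'rV[R]_2, nonsingleton_body K ->
     [/\ diam_MIN K S <= 3 * circumradius K S,
         2 * inradius K S + circumradius K S <= diam_MIN K S &
         diam_MIN K S / (3 * circumradius K S) *
           (1 - diam_MIN K S / (3 * circumradius K S))
         <= inradius K S / circumradius K S]) /\
  BS_diagram S =
    [set p : R * R | [/\ 0 <= p.1, 0 <= p.2, 2 * p.2 <= 3,
                         2 * p.1 + 1 <= 2 * p.2 &
                         2 * p.2 / 3 * (1 - 2 * p.2 / 3) <= p.1]].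
Proof.
have [M frM] := centered_triangle_frame hS hcent.
have ineqs (K : set 'rV[R]_2) : nonsingleton_body K ->
    [/\ 0 < circumradius K S, 0 <= inradius K S,
      diam_MIN K S <= 3 * circumradius K S,
      2 * inradius K S + circumradius K S <= diam_MIN K S &
      diam_MIN K S / (3 * circumradius K S) *
        (1 - diam_MIN K S / (3 * circumradius K S))
      <= inradius K S / circumradius K S].
  move=> [Kbody Kn1]; have [H [k supK]] := support_points_exist (M := M) Kbody.
  have [_ _ cK] := Kbody; have s0 := frame_support_gt0 frM supK Kn1.
  split.
  - by rewrite (frame_circumradius frM supK) divr_gt0.
  - exact: (frame_inradius_ge0 frM supK).
  - exact: (frame_diam_circumradius frM supK).
  - exact: (frame_inradius_diam frM supK).
  - exact: (frame_diam_inradius frM cK supK s0).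
split=> [K /ineqs[]//|]; apply/seteqP; split=> [_ [K Kn1 <-]|[x y]].
  have [] := ineqs _ Kn1; rewrite /f_MIN /=.
  set r := inradius K S; set D := diam_MIN K S; set rad := circumradius K S.
  move=> R0 r0 D3 rD rDlow.
  have -> : 2 * (D / (2 * rad)) = D / rad by field; rewrite gt_eqF.
  have E : D / rad / 3 = D / (3 * rad) by field; rewrite gt_eqF.
  split; rewrite ?E//.
  - by rewrite divr_ge0// ltW.
  - by rewrite divr_ge0//; lra.
  - by rewrite ler_pdivrMr.
  - by rewrite ler_pdivlMr// mulrDl -mulrA divfK ?gt_eqF// mul1r.
move=> /= [x0 y0 y3 xy yx].
(* For 0 <= d < 1 / 2, where d = 2 y / 3, the lower bound d (1 - d) for x exceeds
   the upper bound (3 d - 1) / 2. *)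
have d12 : 1 / 2 <= 2 * y / 3 <= 1.
  apply/andP; split; last by lra.
  rewrite leNgt; apply/negP => d2.
  have : 0 < (1 - 2 * (2 * y / 3)) * (1 + 2 * y / 3) by rewrite mulr_gt0; lra.
  by lra.
have [K [Kn1 rE RE DE]] := extremal_body (x := x) frM d12 yx ltac:(lra).
exists K => //; rewrite /f_MIN rE RE DE divr1 mulr1.
by congr pair; field.
Qed.
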